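(* Let $0<\omega<2$, $\varepsilon>0$ and $$A=\left[\begin{array}{cccc} 1 & \varepsilon & 0 & 0\\ 0 & -1 & \frac{\omega}{\varepsilon} & 0\\ 0 & 0 & 1 & \varepsilon\\ 0 & 0 & 0 & -1 \end{array}\right]\in\mathbb{R}^{4\times 4}.$$ Let $1\le k\le d(A)-1$. If $p_k(z)$ is a $k$th worst-case GMRES polynomial of $A$, then $p_k(-z)$ is also a $k$th worst-case GMRES polynomial of $A$. In particular, for every third worst-case GMRES polynomial $p_3(z)$ of $A$ one has $p_3(z)\neq p_3(-z)$ (as polynomials), so the third worst-case GMRES polynomial of $A$ is not uniquely determined.
   Context: $\|\cdot\|$ is the Euclidean norm, $d(A)$ is the degree of the minimal polynomial of $A$, and $\pi_k$ is the set of real polynomials $p$ of degree at most $k$ with $p(0)=1$. The $k$th worst-case GMRES approximation is $\Psi_k(A)=\max_{v\in\mathbb{R}^n,\,\|v\|=1}\min_{p\in\pi_k}\|p(A)v\|$ (here $n=4$). A polynomial $p_k\in\pi_k$ is a $k$th worst-case GMRES polynomial of $A$ if there is a unit norm vector $b\in\mathbb{R}^n$ (a worst-case initial vector) such that $\|p_k(A)b\|=\min_{p\in\pi_k}\|p(A)b\|=\Psi_k(A)$. *)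

(* Defs.v *)
From HB Require Import structures.
From mathcomp Require Export all_boot all_order all_algebra.
From mathcomp Require Export classical_sets reals.

Set Implicit Arguments.
Unset Strict Implicit.
Unset Printing Implicit Defensive.

Import Order.TTheory GRing.Theory Num.Theory.

Local Open Scope classical_set_scope.
Local Open Scope ring_scope.

(* The library norm on matrices is the max-norm, hence this definition. *)
Definition eucl_norm (R : realType) (n : nat) (v : 'cV[R]_n) : R :=
  Num.sqrt (\sum_i v i ord0 ^+ 2).

Definition minpoly_degree (R : realType) (n : nat) (A : 'M[R]_n.+1) : nat :=
  (size (mxminpoly A)).-1.

Definition gmres_polys (R : realType) (k : nat) : set {poly R} :=
  [set p : {poly R} | (size p <= k.+1)%N /\ p.[0] = 1].

Definition gmres_residual (R : realType) (n : nat) (A : 'M[R]_n.+1)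
    (b : 'cV[R]_n.+1) (p : {poly R}) : R :=
  eucl_norm (horner_mx A p *m b).

(* The minimum is a finite-dimensional least-squares distance and the maximum
   is over a compact sphere, so both are attained and are given by the total
   operators [inf] and [sup]. *)
Definition gmres_min (R : realType) (n : nat) (k : nat) (A : 'M[R]_n.+1)
    (b : 'cV[R]_n.+1) : R :=
  inf [set gmres_residual A b p | p in @gmres_polys R k].

Definition worst_case_gmres (R : realType) (n : nat) (k : nat)
    (A : 'M[R]_n.+1) : R :=
  sup [set gmres_min k A v | v in [set v : 'cV[R]_n.+1 | eucl_norm v = 1]].

(* The two equalities force the minimum to be attained at [p] and the maximum
   to be attained at [b]. *)
Definition worst_case_gmres_poly (R : realType) (n : nat) (k : nat)
    (A : 'M[R]_n.+1) (p : {poly R}) : Prop :=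
  @gmres_polys R k p /\
  exists b : 'cV[R]_n.+1,
    [/\ eucl_norm b = 1,
        gmres_residual A b p = gmres_min k A b
      & gmres_min k A b = worst_case_gmres k A].

Definition toh_matrix (R : realType) (omega eps : R) : 'M[R]_4 :=
  \matrix_(i < 4, j < 4)
    (nth [::] [:: [:: 1;  eps;          0;   0];
                  [:: 0; - 1; omega / eps;   0];
                  [:: 0;   0;           1; eps];
                  [:: 0;   0;           0; - 1]] i)`_j.

(* Main.v *)
Require Import Defs.
From mathcomp Require Import ring lra.
From mathcomp Require Import boolp classical_sets topology normedtype.
Set Implicit Arguments.
Unset Strict Implicit.
Unset Printing Implicit Defensive.
Import Order.TTheory GRing.Theory Num.Theory.
Import numFieldNormedType.Exports.
Local Open Scope classical_set_scope.
Local Open Scope ring_scope.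

(** Write [Psi] for the worst-case value, and let [b] be a worst unit vector with
    optimal polynomial [p] and residual [r = p(A) b], so that [|r| = Psi].  Two
    first-order conditions hold.  Minimality over the polynomials makes [r]
    orthogonal to [A b, ..., A^k b] ([gmres_residual_orthogonal]).  Maximality over
    the sphere gives [p(A)^T r = Psi^2 b] ([worst_case_stationary]), provided that
    [A] is invertible and [Psi] positive, which makes those Krylov vectors
    independent.  Together they say that [r / Psi] is a worst vector for the
    transpose of [A], with the same polynomial [p].  Reversing the coordinates with
    alternating signs is an orthogonal map that conjugates the transpose of the
    matrix at hand to its opposite; so its image of [r / Psi] is a worst vector of
    the matrix itself, now with polynomial [p(-X)]
    ([worst_case_gmres_poly_reflect]).

    For [k = 3] an even [p] would be [1 + a X^2].  The square of the matrix is the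
    Kronecker product of [[1, omega], [0, 1]] with the identity of order two, so
    both conditions become explicit polynomial equations in the coordinates of [b],
    and these force [b = 0] when [0 < omega < 2]
    ([even_residual_system_unsat]).  Hence [p] and [p(-X)] differ.  That some
    worst-case polynomial exists is compactness of the sphere for [b]
    ([worst_case_attained]) and solvability of the normal equations for [p]
    ([gmres_min_attained]). *)

(** * The Euclidean inner product *)

Definition dot (R : realType) (n : nat) (u v : 'cV[R]_n) : R :=
  (u^T *m v) ord0 ord0.

Lemma dotE (R : realType) (n : nat) (u v : 'cV[R]_n) :
  dot u v = \sum_i u i ord0 * v i ord0.
Proof. by rewrite /dot mxE; apply: eq_bigr => i _; rewrite mxE. Qed.

Lemma dotC (R : realType) (n : nat) (u v : 'cV[R]_n) : dot u v = dot v u.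
Proof. by rewrite !dotE; apply: eq_bigr => i _; rewrite mulrC. Qed.

Lemma dotDr (R : realType) (n : nat) (u v w : 'cV[R]_n) :
  dot u (v + w) = dot u v + dot u w.
Proof. by rewrite /dot mulmxDr mxE. Qed.

Lemma dotDl (R : realType) (n : nat) (u v w : 'cV[R]_n) :
  dot (u + v) w = dot u w + dot v w.
Proof. by rewrite dotC dotDr !(dotC w). Qed.

Lemma dotZr (R : realType) (n : nat) (a : R) (u v : 'cV[R]_n) :
  dot u (a *: v) = a * dot u v.
Proof. by rewrite /dot -scalemxAr mxE. Qed.

Lemma dotZl (R : realType) (n : nat) (a : R) (u v : 'cV[R]_n) :
  dot (a *: u) v = a * dot u v.
Proof. by rewrite dotC dotZr dotC. Qed.

Lemma dotNr (R : realType) (n : nat) (u v : 'cV[R]_n) : dot u (- v) = - dot u v.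
Proof. by rewrite -scaleN1r dotZr mulN1r. Qed.

Lemma dotNl (R : realType) (n : nat) (u v : 'cV[R]_n) : dot (- u) v = - dot u v.
Proof. by rewrite dotC dotNr dotC. Qed.

Lemma dot0r (R : realType) (n : nat) (u : 'cV[R]_n) : dot u 0 = 0.
Proof. by rewrite /dot mulmx0 mxE. Qed.

Lemma dot_mull (R : realType) (m n : nat) (B : 'M[R]_(m, n)) (u : 'cV[R]_n)
    (v : 'cV[R]_m) :
  dot (B *m u) v = dot u (B^T *m v).
Proof. by rewrite /dot trmx_mul mulmxA. Qed.

Lemma dot_ge0 (R : realType) (n : nat) (u : 'cV[R]_n) : 0 <= dot u u.
Proof. by rewrite dotE; apply: sumr_ge0 => i _; rewrite -expr2 sqr_ge0. Qed.

Lemma dot_eq0 (R : realType) (n : nat) (u : 'cV[R]_n) : dot u u = 0 -> u = 0.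
Proof.
rewrite dotE => /eqP; rewrite psumr_eq0 => [/allP u0|i _]; last first.
  by rewrite -expr2 sqr_ge0.
apply/matrixP => i j; rewrite (ord1 j) mxE; apply/eqP.
by have := u0 i (mem_index_enum _); rewrite /= mulf_eq0 orbb.
Qed.

Lemma dot_sub (R : realType) (n : nat) (u v : 'cV[R]_n) :
  dot (u - v) (u - v) = dot u u - 2 * dot u v + dot v v.
Proof. by rewrite !(dotDl, dotDr, dotNl, dotNr) (dotC v u); ring. Qed.

Lemma dot_add (R : realType) (n : nat) (u v : 'cV[R]_n) :
  dot (u + v) (u + v) = dot u u + 2 * dot u v + dot v v.
Proof. by rewrite !(dotDl, dotDr) (dotC v u); ring. Qed.

Lemma dot_CauchySchwarz (R : realType) (n : nat) (u v : 'cV[R]_n) :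
  dot u v ^+ 2 <= dot u u * dot v v.
Proof.
have [v0|vN0] := eqVneq (dot v v) 0.
  by rewrite v0 mulr0 (dot_eq0 v0) dot0r expr0n.
have v_gt0 : 0 < dot v v by rewrite lt_def vN0 dot_ge0.
have := dot_ge0 (dot v v *: u - dot u v *: v).
rewrite dot_sub !(dotZl, dotZr) => h.
rewrite -subr_ge0 -(pmulr_lge0 _ v_gt0).
by apply: le_trans h _; rewrite le_eqVlt; apply/orP; left; apply/eqP; ring.
Qed.

Lemma eucl_normE (R : realType) (n : nat) (u : 'cV[R]_n) :
  eucl_norm u = Num.sqrt (dot u u).
Proof. by rewrite /eucl_norm dotE; congr Num.sqrt; apply: eq_bigr. Qed.

Lemma eucl_norm_ge0 (R : realType) (n : nat) (u : 'cV[R]_n) : 0 <= eucl_norm u.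
Proof. by rewrite eucl_normE sqrtr_ge0. Qed.

Lemma eucl_norm_sqr (R : realType) (n : nat) (u : 'cV[R]_n) :
  eucl_norm u ^+ 2 = dot u u.
Proof. by rewrite eucl_normE sqr_sqrtr // dot_ge0. Qed.

Lemma eucl_norm1E (R : realType) (n : nat) (u : 'cV[R]_n) :
  (eucl_norm u = 1) <-> (dot u u = 1).
Proof.
rewrite -eucl_norm_sqr; split=> [->|/eqP]; first by rewrite expr1n.
rewrite -[X in _ == X](expr1n _ 2) eqrXn2 ?ler01 ?eucl_norm_ge0 //.
by move/eqP.
Qed.

Lemma eucl_norm_delta (R : realType) (n : nat) (i : 'I_n) :
  eucl_norm (delta_mx i ord0 : 'cV[R]_n) = 1.
Proof.
apply/eucl_norm1E; rewrite dotE (bigD1 i) //= big1 ?mxE ?eqxx ?mulr1 ?addr0 //.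
by move=> j jNi; rewrite mxE (negPf jNi) mul0r.
Qed.

Lemma dot_quadratic_form_bound (R : realType) (n : nat) (E : 'M[R]_n) :
  exists2 C : R, 0 < C & forall z : 'cV[R]_n, `|dot z (E *m z)| <= C * dot z z.
Proof.
exists (1 + \sum_i \sum_j `|E i j|) => [|z].
  by rewrite ltr_pwDl // sumr_ge0 // => i _; rewrite sumr_ge0.
have z_le i : z i ord0 ^+ 2 <= dot z z.
  rewrite dotE (bigD1 i) //= -expr2 lerDl sumr_ge0 // => j _.
  by rewrite -expr2 sqr_ge0.
have zz_le i j : `|z i ord0 * z j ord0| <= dot z z.
  rewrite ler_norml; have := z_le i; have := z_le j.
  have := sqr_ge0 (z i ord0 - z j ord0); have := sqr_ge0 (z i ord0 + z j ord0).
  rewrite sqrrD sqrrB; lra.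
rewrite dotE mulrDl mul1r; apply: le_trans (ler_wpDl (dot_ge0 z) (lexx _)).
rewrite mulr_suml; apply: le_trans (ler_norm_sum _ _ _) _.
apply: ler_sum => i _; rewrite mxE mulr_sumr mulr_suml.
apply: le_trans (ler_norm_sum _ _ _) _; apply: ler_sum => j _.
by rewrite mulrCA normrM ler_wpM2l.
Qed.

(** Both optimality conditions below arise from this: a function that is nonnegative
    near [0] and vanishes there has derivative zero.  The witness against a nonzero
    [a] is a step [t] against the sign of [a], short enough for the linear term to
    win. *)
Lemma first_order_condition (R : realType) (a b t0 : R) :
  0 < t0 -> (forall t : R, `|t| <= t0 -> 0 <= a * t + b * t ^+ 2) -> a = 0.
Proof.
move=> t0_gt0 h; apply/eqP/negPn/negP => aN0.
pose B := `|b| + `|a| / t0.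
have a_gt0 : 0 < `|a| by rewrite normr_gt0.
have B_gt0 : 0 < B by rewrite ltr_wpDl // divr_gt0.
have bB : b <= B.
  by apply: le_trans (ler_norm _) _; rewrite lerDl divr_ge0 // ltW.
have t_le : `| - a / (2 * B)| <= t0.
  rewrite normrM normrN normfV (gtr0_norm (_ : 0 < 2 * B)) ?mulr_gt0 //.
  rewrite ler_pdivrMr ?mulr_gt0 //.
  have -> : t0 * (2 * B) = 2 * (t0 * `|b|) + 2 * `|a|.
    by rewrite /B; field; rewrite gt_eqF.
  have := mulr_ge0 (ltW t0_gt0) (normr_ge0 b); lra.
have := h _ t_le.
have -> : a * (- a / (2 * B)) + b * (- a / (2 * B)) ^+ 2 =
          (b - 2 * B) * (a / (2 * B)) ^+ 2.
  by field; rewrite gt_eqF.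
rewrite leNgt nmulr_rlt0 ?exprn_even_gt0 //=; last by lra.
by rewrite mulf_neq0 // invr_eq0 mulf_neq0 ?pnatr_eq0 // gt_eqF.
Qed.

(** * Minima and worst cases *)

Lemma gmres_residual_sqr (R : realType) (n : nat) (A : 'M[R]_n.+1)
    (b : 'cV[R]_n.+1) (p : {poly R}) :
  gmres_residual A b p ^+ 2 = dot (horner_mx A p *m b) (horner_mx A p *m b).
Proof. exact: eucl_norm_sqr. Qed.

Lemma gmres_residual_ge0 (R : realType) (n : nat) (A : 'M[R]_n.+1)
    (b : 'cV[R]_n.+1) (p : {poly R}) : 0 <= gmres_residual A b p.
Proof. exact: eucl_norm_ge0. Qed.

Lemma gmres_polys1 (R : realType) (k : nat) : gmres_polys k (1 : {poly R}).
Proof. by rewrite /gmres_polys /= size_poly1 hornerC. Qed.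

Lemma gmres_polysD (R : realType) (k : nat) (p s : {poly R}) :
  gmres_polys k p -> (size s <= k)%N -> gmres_polys k (p + s * 'X).
Proof.
move=> [sp p0] ss; split; last by rewrite hornerD hornerMX p0 mulr0 addr0.
rewrite (leq_trans (size_polyD _ _)) // geq_max sp /=.
have [->|sN0] := eqVneq s 0; first by rewrite mul0r size_poly0.
by rewrite size_mulX.
Qed.

Lemma gmres_polysB (R : realType) (k : nat) (p q : {poly R}) :
  gmres_polys k p -> gmres_polys k q ->
  exists2 s : {poly R}, (size s <= k)%N & q = p + s * 'X.
Proof.
move=> [sp p0] [sq q0].
have : root (q - p) 0 by rewrite /root !hornerE p0 q0 subrr.
case/factor_theorem => s; rewrite subr0 => qp.
exists s; last by rewrite -qp addrC subrK.
have [->|sN0] := eqVneq s 0; first by rewrite size_poly0.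
rewrite -ltnS -(size_mulX sN0) -qp (leq_trans (size_polyD _ _)) //.
by rewrite size_polyN geq_max sp sq.
Qed.

Lemma gmres_polys_reflect (R : realType) (k : nat) (p : {poly R}) :
  gmres_polys k p -> gmres_polys k (p \Po (- 'X)).
Proof.
move=> [sp p0]; split; last by rewrite horner_comp !hornerE oppr0.
apply: leq_trans (size_comp_poly_leq _ _) _.
by rewrite size_polyN size_polyX muln1; case: (size p) sp.
Qed.

Lemma comp_polyNXK (R : realType) : involutive (fun p : {poly R} => p \Po (- 'X)).
Proof.
by move=> p; rewrite -comp_polyA linearN /= comp_polyX opprK comp_polyXr.
Qed.

Lemma gmres_min_le (R : realType) (n k : nat) (A : 'M[R]_n.+1)
    (b : 'cV[R]_n.+1) (q : {poly R}) :
  gmres_polys k q -> gmres_min k A b <= gmres_residual A b q.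
Proof.
move=> kq; apply: ge_inf; last by exists q.
by exists 0 => _ [p _ <-]; exact: gmres_residual_ge0.
Qed.

Lemma gmres_min_ge (R : realType) (n k : nat) (A : 'M[R]_n.+1)
    (b : 'cV[R]_n.+1) (m : R) :
  (forall q, gmres_polys k q -> m <= gmres_residual A b q) ->
  m <= gmres_min k A b.
Proof.
move=> h; apply: lb_le_inf => [|_ [p kp <-]]; last exact: h.
by exists (gmres_residual A b 1), 1 => //; exact: gmres_polys1.
Qed.

Lemma gmres_min_ge0 (R : realType) (n k : nat) (A : 'M[R]_n.+1)
    (b : 'cV[R]_n.+1) : 0 <= gmres_min k A b.
Proof. by apply: gmres_min_ge => q _; exact: gmres_residual_ge0. Qed.

Lemma has_ubound_gmres_min (R : realType) (n k : nat) (A : 'M[R]_n.+1) :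
  has_ubound [set gmres_min k A v | v in [set v | eucl_norm v = 1]].
Proof.
exists 1 => _ [v /= v1 <-]; apply: le_trans (gmres_min_le _ _ (gmres_polys1 _ _)) _.
by rewrite /gmres_residual rmorph1 mul1mx v1.
Qed.

Lemma le_worst_case (R : realType) (n k : nat) (A : 'M[R]_n.+1)
    (v : 'cV[R]_n.+1) :
  eucl_norm v = 1 -> gmres_min k A v <= worst_case_gmres k A.
Proof. by move=> v1; apply: (ub_le_sup (has_ubound_gmres_min _ _)); exists v. Qed.

Lemma worst_case_ge0 (R : realType) (n k : nat) (A : 'M[R]_n.+1) :
  0 <= worst_case_gmres k A.
Proof.
apply: le_trans (le_worst_case k A (eucl_norm_delta R ord0)).
exact: gmres_min_ge0.
Qed.

(** The worst case bounds the residual of every vector by homogeneity; the squared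
    form spares normalising perturbed vectors. *)
Lemma le_worst_case_sqr (R : realType) (n k : nat) (A : 'M[R]_n.+1)
    (v : 'cV[R]_n.+1) (m : R) :
  (forall q, gmres_polys k q ->
     m <= dot (horner_mx A q *m v) (horner_mx A q *m v)) ->
  m <= worst_case_gmres k A ^+ 2 * dot v v.
Proof.
move=> h; have [vv0|vvN0] := eqVneq (dot v v) 0.
  have := h _ (gmres_polys1 _ _).
  by rewrite (dot_eq0 vv0) mulmx0 dot0r mulr0.
have vv_gt0 : 0 < dot v v by rewrite lt_def vvN0 dot_ge0.
have [m_le0|m_gt0] := leP m 0.
  by apply: le_trans m_le0 _; rewrite mulr_ge0 ?sqr_ge0 ?dot_ge0.
have nv_gt0 : 0 < eucl_norm v by rewrite eucl_normE sqrtr_gt0.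
pose w := (eucl_norm v)^-1 *: v.
have w1 : eucl_norm w = 1.
  apply/eucl_norm1E; rewrite dotZl dotZr mulrA -expr2 exprVn eucl_norm_sqr.
  by rewrite mulVf.
rewrite -ler_pdivrMr // -(sqr_sqrtr (ltW (divr_gt0 m_gt0 vv_gt0))).
rewrite lerXn2r ?nnegrE ?sqrtr_ge0 ?worst_case_ge0 //.
apply: le_trans (le_worst_case k A w1); apply: gmres_min_ge => q kq.
rewrite -(ger0_norm (gmres_residual_ge0 _ _ _)) -sqrtr_sqr ler_wsqrtr //.
rewrite gmres_residual_sqr -scalemxAr dotZl dotZr mulrA -expr2 exprVn.
by rewrite eucl_norm_sqr mulrC ler_pM2l ?invr_gt0 // h.
Qed.

(** * Krylov spaces and optimality conditions *)

Definition krylov_mx (R : realType) (n k : nat) (A : 'M[R]_n.+1)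
    (w : 'cV[R]_n.+1) : 'M[R]_(k, n.+1) :=
  \matrix_(j < k) (A ^+ j *m w)^T.

Lemma krylov_mxE (R : realType) (n k : nat) (A : 'M[R]_n.+1)
    (w : 'cV[R]_n.+1) (u : 'rV[R]_k) :
  u *m krylov_mx k A w = (horner_mx A (rVpoly u) *m w)^T.
Proof.
rewrite mulmx_sum_row /rVpoly poly_def rmorph_sum /= mulmx_suml linear_sum /=.
apply: eq_bigr => i _; rewrite rowK valK linearZ /= rmorphXn /= horner_mx_X.
by rewrite -scalemxAl linearZ.
Qed.

(** If the vectors [A b, ..., A^k b] were dependent, a nonzero polynomial of degree
    at most [k] without constant term would annihilate [b]; as [A] is invertible,
    dividing out the powers of the variable leaves one with nonzero constant term,
    whose normalisation would make the residual vanish. *)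
Lemma krylov_mx_free (R : realType) (n k : nat) (A : 'M[R]_n.+1)
    (b : 'cV[R]_n.+1) :
  A \in unitmx -> 0 < gmres_min k A b -> row_free (krylov_mx k A (A *m b)).
Proof.
move=> uA b_gt0; apply/inj_row_free => u; rewrite krylov_mxE => uK.
apply/eqP/negPn/negP => uN0.
have sN0 : rVpoly u != 0.
  by apply: contra_neq uN0 => s0; rewrite -[u]rVpolyK s0 linear0.
have [m [g [g0 sE]]] := multiplicity_XsubC (rVpoly u) 0.
move: g0; rewrite sN0 /= => g0; rewrite subr0 in sE.
have gA : horner_mx A g *m b = 0.
  have : A ^+ m.+1 *m (horner_mx A g *m b) = 0.
    have <- : horner_mx A (rVpoly u * 'X) *m b = A ^+ m.+1 *m (horner_mx A g *m b).
      rewrite sE -mulrA -exprSr mulrC rmorphM rmorphXn /= horner_mx_X.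
      by rewrite -mulmxE mulmxA.
    apply: trmx_inj; rewrite trmx0 -uK rmorphM /= horner_mx_X.
    by rewrite -mulmxE mulmxA.
  move/(congr1 (mulmx (A ^+ m.+1)^-1)); rewrite mulmx0 mulmxA mulmxE mulVr.
    by rewrite mul1mx.
  exact: unitrX.
have: gmres_polys k (g.[0]^-1 *: g).
  split; last by rewrite hornerZ mulVf.
  apply: leq_trans (size_scale_leq _ _) _; apply: leqW.
  have [->|gN0] := eqVneq g 0; first by rewrite size_poly0.
  apply: (@leq_trans (size (rVpoly u))); last exact: size_poly.
  rewrite sE.
  by rewrite size_proper_mul ?lead_coefXn ?mulr1 ?lead_coef_eq0 // size_polyXn
    addnS /= leq_addr.
move/(gmres_min_le A b); rewrite leNgt => /negP; apply.
rewrite /gmres_residual linearZ /= -scalemxAl gA scaler0 eucl_normE dot0r.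
by rewrite sqrtr0.
Qed.

Lemma horner_mxDX (R : realType) (n : nat) (A : 'M[R]_n.+1) (v : 'cV[R]_n.+1)
    (p s : {poly R}) :
  horner_mx A (p + s * 'X) *m v =
  horner_mx A p *m v + horner_mx A s *m (A *m v).
Proof. by rewrite rmorphD rmorphM /= horner_mx_X mulmxDl -mulmxE mulmxA. Qed.

Lemma gmres_residual_orthogonal (R : realType) (n k : nat) (A : 'M[R]_n.+1)
    (b : 'cV[R]_n.+1) (p s : {poly R}) :
  gmres_polys k p -> gmres_residual A b p = gmres_min k A b ->
  (size s <= k)%N -> dot (horner_mx A p *m b) (horner_mx A s *m (A *m b)) = 0.
Proof.
move=> kp pmin ss; set r := horner_mx A p *m b; set z := _ *m (_ *m b).
suff: 2 * dot r z = 0 by lra.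
apply: (@first_order_condition _ _ (dot z z) 1) => // t _.
have kq : gmres_polys k (p + (t *: s) * 'X).
  by apply: gmres_polysD => //; apply: leq_trans (size_scale_leq _ _) ss.
have := gmres_min_le A b kq; rewrite -pmin.
rewrite -(@ler_pXn2r _ 2) ?nnegrE ?gmres_residual_ge0 //.
rewrite !gmres_residual_sqr horner_mxDX linearZ /= -scalemxAl -/r -/z.
by rewrite dot_add dotZl !dotZr; lra.
Qed.

(** A residual orthogonal to the Krylov space is minimal by Pythagoras, and the
    normal equations, whose Gram matrix is invertible when the Krylov vectors are
    independent, produce such a residual. *)
Lemma gmres_min_attained (R : realType) (n k : nat) (A : 'M[R]_n.+1)
    (b : 'cV[R]_n.+1) :
  row_free (krylov_mx k A (A *m b)) ->
  exists2 p, gmres_polys k p & gmres_residual A b p = gmres_min k A b.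
Proof.
set M := krylov_mx _ _ _ => fM.
have uG : M *m M^T \in unitmx.
  rewrite -row_free_unit; apply/inj_row_free => y yG.
  have : dot (y *m M)^T (y *m M)^T = 0.
    by rewrite /dot trmxK trmx_mul mulmxA -(mulmxA y) yG mul0mx mxE.
  move/dot_eq0/(congr1 trmx); rewrite trmxK trmx0 => yM0.
  by apply: (row_free_inj fM); rewrite yM0 mul0mx.
pose y := - (b^T *m M^T *m invmx (M *m M^T)).
have yG : y *m (M *m M^T) = - (b^T *m M^T) by rewrite mulNmx mulmxKV.
(* [p] is chosen so that its residual is orthogonal to the rows of [M]. *)
pose p : {poly R} := 1 + rVpoly y * 'X.
have ss (u : 'rV[R]_k) : (size (rVpoly u) <= k)%N by exact: size_poly.
have kp : gmres_polys k p := gmres_polysD (gmres_polys1 R k) (ss y).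
have rE : horner_mx A p *m b = b + (y *m M)^T.
  by rewrite horner_mxDX rmorph1 mul1mx krylov_mxE trmxK.
exists p => //; apply/eqP; rewrite eq_le gmres_min_le // andbT.
apply: gmres_min_ge => q kq; have [s s_k ->] := gmres_polysB kp kq.
rewrite -(@ler_pXn2r _ 2) ?nnegrE ?gmres_residual_ge0 //.
rewrite !gmres_residual_sqr horner_mxDX.
pose u : 'rV_k := poly_rV s.
have -> : horner_mx A s *m (A *m b) = (u *m M)^T.
  by rewrite krylov_mxE trmxK poly_rV_K.
rewrite dot_add; set r := horner_mx A p *m b.
have -> : dot r (u *m M)^T = 0.
  rewrite /dot /r rE linearD /= trmxK mulmxDl !trmx_mul !mulmxA.
  by rewrite -(mulmxA y) yG mulNmx subrr mxE.
by rewrite mulr0 addr0 lerDl dot_ge0.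
Qed.

(** The envelope argument: perturbing the worst vector [b] to [b + t c] moves its
    minimal squared residual by [2 t <r, p(A) c>] to first order, because the change
    of the minimising polynomial only enters at second order.  Since [b] is a
    maximiser on the sphere this derivative must be proportional to [<b, c>].

    Concretely, a competitor [p + s X] has residual [r + z] at [b] with [z]
    orthogonal to [r], and by independence of the Krylov vectors its effect on [c]
    is a fixed linear function [E z] of [z]; the positive term [|z|^2] then
    absorbs everything that is linear in [z], whatever [s] is. *)
Lemma worst_case_stationary (R : realType) (n k : nat) (A : 'M[R]_n.+1)
    (b : 'cV[R]_n.+1) (p : {poly R}) :
  A \in unitmx -> 0 < worst_case_gmres k A ->
  gmres_polys k p -> eucl_norm b = 1 ->
  gmres_residual A b p = gmres_min k A b ->
  gmres_min k A b = worst_case_gmres k A ->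
  (horner_mx A p)^T *m (horner_mx A p *m b) = worst_case_gmres k A ^+ 2 *: b.
Proof.
move=> uA Psi_gt0 kp /eucl_norm1E bb pmin bworst.
set Psi := worst_case_gmres k A; set r := horner_mx A p *m b.
set M := krylov_mx k A (A *m b).
have fM : row_free M by apply: krylov_mx_free => //; rewrite bworst.
have rr : dot r r = Psi ^+ 2 by rewrite -gmres_residual_sqr pmin bworst.
suff stat c : dot r (horner_mx A p *m c) = Psi ^+ 2 * dot b c.
  apply/subr0_eq/dot_eq0; set h := _ - _.
  rewrite {1}/h dotDl dotNl dotZl -stat.
  by rewrite dot_mull trmxK subrr.
set d := horner_mx A p *m c.
(* [E] sends [s(A) A b] to [s(A) A c]: read off the coefficients of [s] in the
   Krylov basis at [b], then use them at [c]. *)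
pose E := (pinvmx M *m krylov_mx k A (A *m c))^T.
have [C C_gt0 CE] := dot_quadratic_form_bound E.
pose a := d + E^T *m r.
(* For [4 C |t| <= 1] half of [|z|^2] absorbs [2 t <z, E z>]; the other half absorbs
   [2 t <a, z>] at the cost of [2 t^2 |a|^2]. *)
suff : 2 * (Psi ^+ 2 * dot b c - dot r d) = 0 by lra.
apply: (@first_order_condition _ _ (Psi ^+ 2 * dot c c + 2 * dot a a)
          (4 * C)^-1) => [|t t_le]; first by rewrite invr_gt0 mulr_gt0.
suff : Psi ^+ 2 + 2 * t * dot r d - 2 * t ^+ 2 * dot a a <=
       Psi ^+ 2 * dot (b + t *: c) (b + t *: c).
  by rewrite dot_add !(dotZl, dotZr) bb; lra.
apply: le_worst_case_sqr => q kq; have [s s_k ->] := gmres_polysB kp kq.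
set z := horner_mx A s *m (A *m b).
have rz : dot r z = 0 by exact: (gmres_residual_orthogonal (k := k)).
have sc : horner_mx A s *m (A *m c) = E *m z.
  have zE : z^T = poly_rV s *m M.
    by rewrite krylov_mxE poly_rV_K.
  apply: trmx_inj; rewrite [RHS]trmx_mul zE /E trmxK.
  by rewrite -mulmxA (mulmxA M) mulmxVp // mul1mx krylov_mxE poly_rV_K.
have -> : horner_mx A (p + s * 'X) *m (b + t *: c) =
          (r + z) + t *: (d + E *m z).
  by rewrite mulmxDr -scalemxAr !horner_mxDX sc.
have az : dot a z = dot d z + dot r (E *m z).
  by rewrite dotDl (dot_mull E^T) trmxK.
have zEz : - (dot z z / 2) <= 2 * t * dot z (E *m z).
  have tC : `|t| * C <= 4^-1.
    by rewrite -ler_pdivlMr // -invfM.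
  rewrite lerNl; apply: le_trans (ler_norm _) _.
  rewrite normrN !normrM (ger0_norm (_ : 0 <= 2)) //.
  apply: (@le_trans _ _ (2 * (`|t| * (C * dot z z)))).
    by rewrite -mulrA ler_pM2l // ler_wpM2l.
  have := ler_wpM2r (dot_ge0 z) tC; lra.
have := dot_ge0 (z + (2 * t) *: a); rewrite dot_add !(dotZl, dotZr) (dotC z a) => za.
have := mulr_ge0 (sqr_ge0 t) (dot_ge0 (d + E *m z)) => tt.
rewrite (dot_add (r + z)) (dot_add r) rr rz !(dotZl, dotZr).
have -> : dot (r + z) (d + E *m z) = dot r d + dot a z + dot z (E *m z).
  by rewrite dotDl !dotDr az (dotC z d); ring.
lra.
Qed.

(** * Existence of worst-case vectors *)

Lemma continuous_dot_mulmx (R : realType) (m n : nat) (B : 'M[R]_(m, n)) :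
  continuous (fun u : 'rV[R]_n => dot (B *m u^T) (B *m u^T)).
Proof.
have -> : (fun u : 'rV[R]_n => dot (B *m u^T) (B *m u^T)) =
    (fun u => \sum_i (\sum_j B i j * u ord0 j) * (\sum_j B i j * u ord0 j)).
  apply/funext => u; rewrite dotE; apply: eq_bigr => i _; rewrite mxE.
  by congr (_ * _); apply: eq_bigr => j _; rewrite mxE.
have cBi i : continuous (fun v : 'rV[R]_n => \sum_j B i j * v ord0 j).
  apply: (@continuous_big R _ +%R 0 xpredT); first exact: add_continuous.
  move=> j _ u; apply: continuousM; first exact: cst_continuous.
  exact: coord_continuous.
apply: (@continuous_big R _ +%R 0 xpredT); first exact: add_continuous.
by move=> i _ u; apply: continuousM; exact: cBi.
Qed.

Lemma compact_sphere (R : realType) (n : nat) :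
  compact [set u : 'rV[R]_n | dot u^T u^T = 1].
Proof.
have cube : compact [set u : 'rV[R]_n | forall i, `[-1, 1]%classic (u ord0 i)].
  by apply: (@rV_compact R n (fun=> `[(-1 : R), 1]%classic)) => i; exact: segment_compact.
apply: subclosed_compact cube _ => [|u /= u1 i]; last first.
  rewrite /= in_itv /= -ler_norml -(@ler_pXn2r _ 2) ?nnegrE //.
  rewrite real_normK ?num_real // expr1n -u1 dotE (bigD1 i) //= !mxE -expr2.
  by rewrite lerDl sumr_ge0 // => j _; rewrite -expr2 sqr_ge0.
have -> : [set u : 'rV[R]_n | dot u^T u^T = 1] =
    (fun u => dot (1%:M *m u^T) (1%:M *m u^T)) @^-1` [set 1].
  by apply/funext => u; rewrite /preimage /= mul1mx.
apply: preimage_closed => [u _|]; last exact: closed_eq.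
exact: continuous_dot_mulmx.
Qed.

(** Being an infimum of continuous functions of the vector, the minimal residual is
    upper semicontinuous, which is all that a maximum over the sphere requires. *)
Lemma worst_case_attained (R : realType) (n k : nat) (A : 'M[R]_n.+1) :
  exists2 b, eucl_norm b = 1 & gmres_min k A b = worst_case_gmres k A.
Proof.
set Psi := worst_case_gmres k A.
pose near_max (e : R) :=
  [set u : 'rV[R]_n.+1 | dot u^T u^T = 1 /\ Psi - e < gmres_min k A u^T].
(* A cluster point of the near-maximisers is a maximiser. *)
pose F := filter_from [set e : R | 0 < e] near_max.
have FF : ProperFilter F.
  apply: filter_from_proper => [|e /= e_gt0].
    apply: filter_from_filter; first by exists 1 => /=.
    move=> e e' /= e_gt0 e'_gt0; exists (Num.min e e') => /=.
      by rewrite lt_min e_gt0.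
    move=> u [u1 uP]; split; split=> //; apply: le_lt_trans uP.
      by rewrite lerD2l lerN2 ge_min lexx.
    by rewrite lerD2l lerN2 ge_min lexx orbT.
  have ne : [set gmres_min k A v | v in [set v | eucl_norm v = 1]] !=set0.
    exists (gmres_min k A (delta_mx ord0 ord0)), (delta_mx ord0 ord0) => //=.
    exact: eucl_norm_delta.
  have [_ [v /= v1 <-] vP] :=
    sup_adherent e_gt0 (conj ne (has_ubound_gmres_min k A)).
  by exists v^T; split; rewrite trmxK //; exact/eucl_norm1E.
have [|u [/= u1 uF]] := @compact_sphere R n.+1 F FF.
  by exists 1 => //= u [].
have u1' : eucl_norm u^T = 1 by apply/eucl_norm1E.
exists u^T => //; apply/eqP; rewrite eq_le le_worst_case //=.
apply: gmres_min_ge => q kq; rewrite leNgt; apply/negP => q_lt.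
pose m := (gmres_residual A u^T q + Psi) / 2.
have m_ge0 : 0 <= m.
  by rewrite divr_ge0 // addr_ge0 ?gmres_residual_ge0 ?worst_case_ge0.
have Fm : F (near_max (Psi - m)) by exists (Psi - m) => //=; rewrite /m; lra.
pose g (v : 'rV[R]_n.+1) := dot (horner_mx A q *m v^T) (horner_mx A q *m v^T).
have nm : nbhs u [set v | g v < m ^+ 2].
  apply: (@continuous_dot_mulmx _ _ _ (horner_mx A q) u [set y | y < m ^+ 2]).
  apply: open_nbhs_nbhs; split; first exact: open_lt.
  rewrite /= -gmres_residual_sqr ltrXn2r //.
    exact: gmres_residual_ge0.
  by rewrite /m; lra.
have [v [[v1 mv] /= gv]] := uF _ _ Fm nm.
have := gmres_min_le A v^T kq; apply/negP; rewrite -ltNge.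
apply: (@lt_trans _ _ m); last by rewrite opprB addrC subrK in mv.
rewrite -(@ltr_pXn2r _ 2) ?nnegrE ?gmres_residual_ge0 //.
by rewrite gmres_residual_sqr.
Qed.

(** * The reflection symmetry *)

(** For orthogonal [Q] the hypothesis reads [- A = Q A^T Q^-1], whence
    [p(- A) = Q p(A)^T Q^-1]. *)
Lemma horner_mx_reflect (R : realType) (n : nat) (A Q : 'M[R]_n.+1)
    (p : {poly R}) :
  A *m Q = - (Q *m A^T) ->
  horner_mx A (p \Po (- 'X)) *m Q = Q *m (horner_mx A p)^T.
Proof.
move=> AQ; elim/poly_ind: p => [|p c IHp].
  by rewrite comp_poly0 !rmorph0 trmx0 mul0mx mulmx0.
rewrite comp_poly_MXaddC !rmorphD !rmorphM rmorphN /= !horner_mx_C horner_mx_X.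
rewrite linearD /= mulmxDl mulmxDr tr_scalar_mx scalar_mxC; congr (_ + _).
rewrite mulrN mulNmx -mulmxE -mulmxA AQ mulmxN opprK mulmxA IHp -mulmxA.
rewrite -trmx_mul; congr (_ *m _^T).
exact: comm_mx_horner.
Qed.

(** If [b] is worst for [A] with residual [r = p(A) b], then [r] is worst for the
    transpose: every residual of [r] has inner product [|r|^2] with [b] by
    orthogonality, while stationarity says that [p] sends [r] back to a multiple of
    [b].  The orthogonal matrix [Q] turns the transpose into [- A]. *)
Lemma worst_case_gmres_poly_reflect (R : realType) (n k : nat)
    (A Q : 'M[R]_n.+1) (p : {poly R}) :
  A \in unitmx -> 0 < worst_case_gmres k A ->
  Q^T *m Q = 1%:M -> A *m Q = - (Q *m A^T) ->
  worst_case_gmres_poly k A p -> worst_case_gmres_poly k A (p \Po (- 'X)).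
Proof.
move=> uA Psi_gt0 QQ AQ [kp [b [b1 pmin bworst]]].
have stat := worst_case_stationary uA Psi_gt0 kp b1 pmin bworst.
have PsiN0 := lt0r_neq0 Psi_gt0.
move: stat; set Psi := worst_case_gmres k A; set r := horner_mx A p *m b => stat.
have bb : dot b b = 1 by apply/eucl_norm1E.
have rr : dot r r = Psi ^+ 2 by rewrite -gmres_residual_sqr pmin bworst.
have dotQ u : dot (Q *m u) (Q *m u) = dot u u by rewrite dot_mull mulmxA QQ mul1mx.
(* The residual of [b'] under [q] is, up to [Q], that of [Psi^-1 *: r] under the
   reflected polynomial at the transpose. *)
pose b' := Q *m (Psi^-1 *: r).
have b'1 : eucl_norm b' = 1.
  by apply/eucl_norm1E; rewrite dotQ dotZl dotZr rr; field.
have b'E q : horner_mx A q *m b' =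
    Q *m ((horner_mx A (q \Po (- 'X)))^T *m (Psi^-1 *: r)).
  by rewrite !mulmxA -horner_mx_reflect // comp_polyNXK.
have b'p : gmres_residual A b' (p \Po (- 'X)) = Psi.
  rewrite /gmres_residual eucl_normE b'E dotQ comp_polyNXK -scalemxAr stat.
  rewrite !(dotZl, dotZr) bb (_ : _ * _ = Psi ^+ 2); last by field.
  by rewrite sqrtr_sqr ger0_norm // ltW.
have b'min : gmres_min k A b' = Psi.
  have kp' := gmres_polys_reflect kp.
  apply/eqP; rewrite eq_le -{1}b'p (gmres_min_le A b' kp') /=.
  apply: gmres_min_ge => q kq.
  rewrite -(@ler_pXn2r _ 2) ?nnegrE ?gmres_residual_ge0 //; last exact: ltW.
  rewrite gmres_residual_sqr b'E dotQ; set y := _ *m _.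
  have <- : dot y b = Psi.
    have [s s_k qE] := gmres_polysB kp (gmres_polys_reflect kq).
    rewrite /y dot_mull trmxK qE horner_mxDX dotDr !dotZl rr.
    by rewrite (gmres_residual_orthogonal kp) //; field.
  by apply: le_trans (dot_CauchySchwarz _ _) _; rewrite bb mulr1.
by split; [exact: gmres_polys_reflect | exists b'; rewrite b'p b'min].
Qed.

(** A vector [w] orthogonal to [A b, ..., A^k b] but not to [b] has the same nonzero
    inner product with every residual of [b], so these stay away from zero. *)
Lemma worst_case_gt0 (R : realType) (n k : nat) (A : 'M[R]_n.+1)
    (b w : 'cV[R]_n.+1) :
  (forall j : 'I_k, dot (A ^+ j *m (A *m b)) w = 0) -> dot w b != 0 ->
  0 < worst_case_gmres k A.
Proof.
move=> Kw wb.
have ww : 0 < dot w w.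
  rewrite lt_def dot_ge0 andbT; apply: contra_neq wb => /dot_eq0 ->.
  by rewrite dotC dot0r.
have : dot w b ^+ 2 / dot w w <= worst_case_gmres k A ^+ 2 * dot b b.
  apply: le_worst_case_sqr => q kq; rewrite ler_pdivrMr // mulrC.
  have [s s_k ->] := gmres_polysB (gmres_polys1 R k) kq.
  suff <- : dot w (horner_mx A (1 + s * 'X) *m b) = dot w b.
    exact: dot_CauchySchwarz.
  rewrite horner_mxDX rmorph1 mul1mx dotDr -[RHS]addr0; congr (_ + _).
  rewrite dotC -(poly_rV_K s_k) -[_ *m (_ *m _)]trmxK -krylov_mxE /dot trmxK.
  rewrite -mulmxA (_ : _ *m w = 0) ?mulmx0 ?mxE //.
  apply/row_matrixP => j; rewrite row_mul rowK row0.
  by apply/matrixP => i i'; rewrite !ord1 [RHS]mxE; exact: Kw.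
rewrite lt_def worst_case_ge0 andbT => wPsi; apply: contraTneq wPsi => ->.
by rewrite expr0n mul0r -ltNge divr_gt0 ?exprn_even_gt0.
Qed.

(** * The four by four matrix *)

Definition col4 (R : realType) (x1 x2 x3 x4 : R) : 'cV[R]_4 :=
  \col_i [:: x1; x2; x3; x4]`_i.

Lemma col4_eta (R : realType) (v : 'cV[R]_4) :
  exists x1 x2 x3 x4, v = col4 x1 x2 x3 x4.
Proof.
exists (v (inord 0) ord0), (v (inord 1) ord0), (v (inord 2) ord0).
exists (v (inord 3) ord0); apply/matrixP => i j; rewrite (ord1 j) mxE.
by case: i => [[|[|[|[|i]]]] lt_i] //=; congr (v _ _); apply: val_inj;
  rewrite /= inordK.
Qed.

Lemma dot_col4 (R : realType) (x1 x2 x3 x4 y1 y2 y3 y4 : R) :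
  dot (col4 x1 x2 x3 x4) (col4 y1 y2 y3 y4) =
  x1 * y1 + x2 * y2 + x3 * y3 + x4 * y4.
Proof. by rewrite dotE !big_ord_recr big_ord0 /= !mxE add0r. Qed.

Lemma col4D (R : realType) (x1 x2 x3 x4 y1 y2 y3 y4 : R) :
  col4 x1 x2 x3 x4 + col4 y1 y2 y3 y4 =
  col4 (x1 + y1) (x2 + y2) (x3 + y3) (x4 + y4).
Proof. by apply/matrixP => -[[|[|[|[|i]]]] lt_i] j //; rewrite !mxE. Qed.

Lemma col4Z (R : realType) (a x1 x2 x3 x4 : R) :
  a *: col4 x1 x2 x3 x4 = col4 (a * x1) (a * x2) (a * x3) (a * x4).
Proof. by apply/matrixP => -[[|[|[|[|i]]]] lt_i] j //; rewrite !mxE. Qed.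

Lemma toh_matrix_col4 (R : realType) (omega eps x1 x2 x3 x4 : R) :
  toh_matrix omega eps *m col4 x1 x2 x3 x4 =
  col4 (x1 + eps * x2) (omega / eps * x3 - x2) (x3 + eps * x4) (- x4).
Proof.
apply/matrixP => i j; rewrite (ord1 j) !mxE !big_ord_recr big_ord0 /= !mxE /=.
by case: i => [[|[|[|[|i]]]] lt_i] //=; ring.
Qed.

Lemma toh_matrix_unit (R : realType) (omega eps : R) :
  toh_matrix omega eps \in unitmx.
Proof.
rewrite -unitmx_tr unitmxE det_trig.
  by rewrite !big_ord_recr big_ord0 /= !mxE /= !(mul1r, mulr1, mulrN1) opprK unitr1.
apply/is_trig_mxP => -[[|[|[|[|i]]]] lt_i] [[|[|[|[|j]]]] lt_j] //= _;
  by rewrite !mxE.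
Qed.

(** Transposing and reversing the coordinates exchanges the signs on the diagonal and
    keeps the superdiagonal; the alternating signs then turn the result into the
    opposite of the matrix. *)
Definition signed_flip (R : realType) : 'M[R]_4 :=
  \matrix_(i, j) ((-1) ^+ i *+ (i + j == 3)%N).

Lemma signed_flip_orthogonal (R : realType) :
  (signed_flip R)^T *m signed_flip R = 1%:M.
Proof.
apply/matrixP => i j; rewrite !mxE !big_ord_recr big_ord0 /= !mxE /=.
by case: i => [[|[|[|[|i]]]] lt_i] //=; case: j => [[|[|[|[|j]]]] lt_j] //=;
  rewrite ?mulr0n ?mulr1n; ring.
Qed.

Lemma toh_matrix_flip (R : realType) (omega eps : R) :
  toh_matrix omega eps *m signed_flip R =
  - (signed_flip R *m (toh_matrix omega eps)^T).
Proof.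
apply/matrixP => i j; rewrite !mxE !big_ord_recr !big_ord0 /= !mxE /=.
by case: i => [[|[|[|[|i]]]] lt_i] //=; case: j => [[|[|[|[|j]]]] lt_j] //=;
  rewrite ?mulr0n ?mulr1n; ring.
Qed.

Lemma toh_worst_case_gt0 (R : realType) (omega eps : R) (k : nat) :
  0 < omega -> 0 < eps -> (k <= 3)%N ->
  0 < worst_case_gmres k (toh_matrix omega eps).
Proof.
move=> omega_gt0 eps_gt0 k3.
(* The last basis vector is cyclic, so the orthogonal complement of its first three
   images is a line; the witness spans it. *)
apply: (@worst_case_gt0 _ _ _ _ (col4 0 0 0 1)
          (col4 1 eps (- omega) (- omega * eps))); last first.
  by rewrite dot_col4 !mulr0 !add0r mulr1 mulNr oppr_eq0 mulf_neq0 ?gt_eqF.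
have epsN0 := lt0r_neq0 eps_gt0.
case=> [[|[|[|j]]] lt_j] /=; last by have := leq_trans lt_j k3.
- by rewrite expr0 mul1mx !toh_matrix_col4 dot_col4; ring.
- by rewrite expr1 !toh_matrix_col4 dot_col4; field.
- by rewrite expr2 -mulmxE -mulmxA !toh_matrix_col4 dot_col4; field.
Qed.

(** * Worst-case polynomials are not even *)

(** A real polynomial that agrees with its reflection and has degree at most three
    is quadratic without linear term: compare the values at [1] and at [2]. *)
Lemma even_gmres_poly3 (R : realType) (p : {poly R}) :
  gmres_polys 3 p -> p = p \Po (- 'X) -> exists a : R, p = 1 + a *: 'X^2.
Proof.
move=> [sp p0] peven.
have pE x : p.[x] = p`_0 + p`_1 * x + p`_2 * x ^+ 2 + p`_3 * x ^+ 3.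
  by rewrite (horner_coef_wide _ sp) !big_ord_recr big_ord0 /= expr0 expr1; ring.
have pN x : p.[x] = p.[- x] by rewrite {1}peven horner_comp !hornerE.
have := pN 1; have := pN 2; have := pE 0; rewrite p0 !pE => p1 p2 p3.
have c0 : p`_0 = 1 by lra.
have c1 : p`_1 = 0 by lra.
have c3 : p`_3 = 0 by lra.
exists p`_2; apply/polyP => -[|[|[|[|i]]]];
  rewrite !(coefD, coefC, coefZ, coefXn) /= ?mulr0 ?mulr1 ?add0r ?addr0 //.
by rewrite nth_default // (leq_trans sp).
Qed.

(** The coordinate form of the optimality conditions for the quadratic polynomial
    [1 + a X^2], whose value at the matrix is the Kronecker product of
    [[1 + a, a w], [0, 1 + a]] with the identity of order two; [L] stands for the
    squared worst-case residual.  Generically the eigenvectors of the Gram matrix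
    are decomposable, that is [(b3, b4)] is a multiple [c] of [(b1, b2)], and the
    orthogonality to [A b] and [A^3 b] then asks two quadratic forms whose only
    common real zero is the origin to vanish at [(b1, b2)].  For [a = 0]
    the orthogonality to [A^2 b] contradicts [w < 2]. *)
Lemma even_residual_system_unsat (R : realType) (w e a L b1 b2 b3 b4 : R) :
  0 < w -> w < 2 -> 0 < e -> 0 < L ->
  let r1 := (1 + a) * b1 + a * w * b3 in
  let r2 := (1 + a) * b2 + a * w * b4 in
  let r3 := (1 + a) * b3 in
  let r4 := (1 + a) * b4 in
  (1 + a) * r1 = L * b1 -> (1 + a) * r2 = L * b2 ->
  r1 * (b1 + e * b2) + r2 * (w / e * b3 - b2) + r3 * (b3 + e * b4)
    + r4 * (- b4) = 0 ->
  r1 * (b1 + w * b3) + r2 * (b2 + w * b4) + r3 * b3 + r4 * b4 = 0 ->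
  r1 * (b1 + w * b3 + e * (b2 + w * b4)) + r2 * (w / e * b3 - (b2 + w * b4))
    + r3 * (b3 + e * b4) + r4 * (- b4) = 0 ->
  b1 ^+ 2 + b2 ^+ 2 + b3 ^+ 2 + b4 ^+ 2 = 0.
Proof.
move=> w0 w2 e0 L0 r1 r2 r3 r4 s1 s2 o1 o2 o3.
have wN0 := lt0r_neq0 w0; have eN0 := lt0r_neq0 e0; have LN0 := lt0r_neq0 L0.
have o13 : r1 * (b3 + e * b4) - r2 * b4 = 0 by apply: (mulfI wN0); lra.
have [a0|aN0] := eqVneq a 0.
  have := sqr_ge0 (b1 + b3); have := sqr_ge0 (b2 + b4).
  have := sqr_ge0 (b1 - b3); have := sqr_ge0 (b2 - b4).
  move: o2; rewrite /r1 /r2 /r3 /r4 a0 !sqrrB !sqrrD => o2 h1 h2 h3 h4.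
  nra.
have [be0|beN0] := eqVneq (1 + a) 0.
  have b1_0 : b1 = 0 by apply: (mulfI LN0); rewrite -s1 be0; ring.
  have b2_0 : b2 = 0 by apply: (mulfI LN0); rewrite -s2 be0; ring.
  apply: (mulfI (mulf_neq0 aN0 (mulf_neq0 wN0 wN0))).
  by rewrite mulr0 -[RHS]o2 /r1 /r2 /r3 /r4 be0 b1_0 b2_0; ring.
(* Solving the eigenvector equation [s1] for [b3] gives the ratio [c]. *)
pose c := (L - (1 + a) ^+ 2) / (a * (1 + a) * w).
have b3E : b3 = c * b1.
  move: (s1); rewrite /r1 => h; apply: (mulfI (mulf_neq0 (mulf_neq0 aN0 beN0) wN0)).
  rewrite /c; transitivity (L * b1 - (1 + a) ^+ 2 * b1).
    by rewrite -h; ring.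
  by field; rewrite aN0 beN0 wN0.
have b4E : b4 = c * b2.
  move: (s2); rewrite /r2 => h; apply: (mulfI (mulf_neq0 (mulf_neq0 aN0 beN0) wN0)).
  rewrite /c; transitivity (L * b2 - (1 + a) ^+ 2 * b2).
    by rewrite -h; ring.
  by field; rewrite aN0 beN0 wN0.
suff [b1_0 b2_0] : b1 = 0 /\ b2 = 0 by rewrite b3E b4E b1_0 b2_0; ring.
pose g := L / (1 + a); have gN0 : g != 0 by rewrite mulf_neq0 ?invr_eq0.
have r1E : r1 = g * b1 by apply: (mulfI beN0); rewrite s1 /g; field.
have r2E : r2 = g * b2 by apply: (mulfI beN0); rewrite s2 /g; field.
move: o1 o2 o13; rewrite r1E r2E /r3 /r4 b3E b4E => o1 o2 o13.
(* If [c = 0] then the orthogonality to [A^2 b] suffices. *)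
have [c0|cN0] := eqVneq c 0.
  have : b1 ^+ 2 + b2 ^+ 2 = 0.
    by apply: (mulfI gN0); rewrite mulr0 -[RHS]o2 c0; ring.
  by move/eqP; rewrite paddr_eq0 ?sqr_ge0 // !sqrf_eq0 => /andP[/eqP -> /eqP ->].
have J0 : b1 ^+ 2 + e * b1 * b2 - b2 ^+ 2 = 0.
  by apply: (mulfI (mulf_neq0 gN0 cN0)); rewrite mulr0 -[RHS]o13; ring.
have b12 : b1 * b2 = 0.
  apply: (mulfI (mulf_neq0 (mulf_neq0 gN0 cN0) (mulf_neq0 wN0 (invr_neq0 eN0)))).
  rewrite mulr0 -[RHS]o1 -[LHS]addr0 -[X in _ + X](mulr0 (g + (1 + a) * c ^+ 2)).
  by rewrite -[in LHS]J0; ring.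
move: (J0); rewrite -mulrA b12 mulr0 addr0 => /eqP; rewrite subr_eq0 => /eqP sq.
have /eqP := b12; rewrite mulf_eq0 => /orP[/eqP b0|/eqP b0].
  by split=> //; apply/eqP; rewrite -sqrf_eq0 -sq b0 expr0n.
by split=> //; apply/eqP; rewrite -sqrf_eq0 sq b0 expr0n.
Qed.

Lemma toh_worst_case_poly_not_even (R : realType) (omega eps : R)
    (p : {poly R}) :
  0 < omega -> omega < 2 -> 0 < eps ->
  worst_case_gmres_poly 3 (toh_matrix omega eps) p -> p <> p \Po (- 'X).
Proof.
move=> omega_gt0 omega_lt2 eps_gt0 [kp [b [b1 pmin bworst]]].
case/(even_gmres_poly3 kp) => a pE.
have Psi_gt0 := toh_worst_case_gt0 omega_gt0 eps_gt0 (leqnn 3).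
have stat := worst_case_stationary (toh_matrix_unit _ _) Psi_gt0 kp b1 pmin bworst.
have orth s := gmres_residual_orthogonal (s := s) kp pmin.
move/eucl_norm1E: b1 => bb.
set A := toh_matrix omega eps in stat orth Psi_gt0.
have pA v : horner_mx A p *m v = v + a *: (A *m (A *m v)).
  rewrite pE rmorphD /= horner_mxZ rmorph1 rmorphXn /= horner_mx_X mulmxDl mul1mx.
  by rewrite -scalemxAl expr2 -mulmxE mulmxA.
have {}stat v : dot (horner_mx A p *m b) (horner_mx A p *m v) =
    worst_case_gmres 3 A ^+ 2 * dot b v.
  by rewrite -dotZl -stat [in RHS]dot_mull trmxK.
have := orth 'X^2; rewrite size_polyXn => /(_ isT).
have := orth 'X; rewrite size_polyX => /(_ isT).
have := orth 1; rewrite size_poly1 => /(_ isT).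
rewrite rmorph1 mul1mx rmorphXn /= horner_mx_X expr2 -mulmxE -mulmxA !pA.
have := stat (col4 0 1 0 0); have := stat (col4 1 0 0 0).
have [b1 [b2 [b3 [b4 bE]]]] := col4_eta b; move: bb; rewrite !pA bE.
rewrite !(toh_matrix_col4, col4Z, col4D, dot_col4) => bb s1 s2 o1 o2 o3.
have epsN0 := lt0r_neq0 eps_gt0.
have Psi2_gt0 : 0 < worst_case_gmres 3 A ^+ 2 by rewrite exprn_gt0.
suff : b1 ^+ 2 + b2 ^+ 2 + b3 ^+ 2 + b4 ^+ 2 = 0 by move: bb; lra.
apply: (@even_residual_system_unsat _ omega eps a _ _ _ _ _ omega_gt0 omega_lt2
  eps_gt0 Psi2_gt0).
- transitivity (worst_case_gmres 3 A ^+ 2 *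
                (b1 * 1 + b2 * 0 + b3 * 0 + b4 * 0)); last by ring.
  by rewrite -s1; field.
- transitivity (worst_case_gmres 3 A ^+ 2 *
                (b1 * 0 + b2 * 1 + b3 * 0 + b4 * 0)); last by ring.
  by rewrite -s2; field.
- by rewrite -[RHS]o1; field.
- by rewrite -[RHS]o2; field.
- by rewrite -[RHS]o3; field.
Qed.

Lemma minpoly_degree_le (R : realType) (n : nat) (A : 'M[R]_n.+1) :
  (minpoly_degree A <= n.+1)%N.
Proof.
rewrite /minpoly_degree -ltnS prednK ?size_mxminpoly //.
rewrite -size_mxminpoly -(size_char_poly A) dvdp_leq ?mxminpoly_dvd_char //.
exact/monic_neq0/char_poly_monic.
Qed.

Theorem theorem4p1 (R : realType) (omega eps : R)
    (homega0 : 0 < omega) (homega2 : omega < 2) (heps : 0 < eps) :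
  let A := toh_matrix omega eps in
  (forall k : nat, (1 <= k <= (minpoly_degree A).-1)%N ->
     forall p : {poly R},
       worst_case_gmres_poly k A p -> worst_case_gmres_poly k A (p \Po (- 'X)))
  /\ (forall p : {poly R}, worst_case_gmres_poly 3 A p -> p <> p \Po (- 'X))
  /\ (exists p q : {poly R},
        [/\ worst_case_gmres_poly 3 A p, worst_case_gmres_poly 3 A q & p <> q]).
Proof.
move=> A.
have reflect k p : (k <= 3)%N ->
    worst_case_gmres_poly k A p -> worst_case_gmres_poly k A (p \Po (- 'X)).
  move=> k3; apply: (@worst_case_gmres_poly_reflect _ _ _ _ (signed_flip R)).
  - exact: toh_matrix_unit.
  - exact: toh_worst_case_gt0.
  - exact: signed_flip_orthogonal.
  - exact: toh_matrix_flip.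
have not_even p : worst_case_gmres_poly 3 A p -> p <> p \Po (- 'X).
  exact: toh_worst_case_poly_not_even.
split=> [k /andP[_ k_le] p|]; last split=> //.
  apply: reflect; apply: leq_trans k_le _.
  by rewrite -subn1 leq_subLR; exact: minpoly_degree_le.
have [b b1 bworst] := worst_case_attained 3 A.
have bfree : row_free (krylov_mx 3 A (A *m b)).
  by apply: krylov_mx_free; rewrite ?toh_matrix_unit // bworst toh_worst_case_gt0.
have [p kp pmin] := gmres_min_attained bfree.
have pworst : worst_case_gmres_poly 3 A p by split=> //; exists b.
by exists p, (p \Po (- 'X)); split; [|exact: reflect|exact: not_even].
Qed.
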